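(* Let $r\le e\le q$ be positive integers with $r+e+q=n$, let $P_1=(x_1,\dots,x_r)$, $P_2=(x_{r+1},\dots,x_{r+e})$, $P_3=(x_{r+e+1},\dots,x_{r+e+q})$ be prime ideals of $S=K[x_1,\dots,x_n]$, and let $I=P_1\cap P_2\cap P_3$. Then, except in the case when $e=r+1$ and $r$ is odd, $$\operatorname{sdepth}(S/I)\le r+\min\left\{e,\left\lceil\frac{q}{2}\right\rceil\right\}.$$
   Context: $K$ is a field and $S=K[x_1,\dots,x_n]$ is the polynomial ring, with its standard $\mathbb{Z}^n$-grading. Let $M$ be a finitely generated $\mathbb{Z}^n$-graded $S$-module. For a homogeneous $u\in M$ and a subset $Z\subset\{x_1,\dots,x_n\}$, $uK[Z]$ denotes the $K$-subspace of $M$ generated by all $uv$, $v$ a monomial in $K[Z]$; if $uK[Z]$ is a free $K[Z]$-module it is called a Stanley space of dimension $|Z|$. A Stanley decomposition of $M$ is a presentation of $M$ as a finite direct sum of $\mathbb{Z}^n$-graded $K$-vector spaces $\mathcal{D}: M=\bigoplus_{i=1}^{s}u_iK[Z_i]$ with each $u_iK[Z_i]$ a Stanley space; $\operatorname{sdepth}\mathcal{D}=\min_i|Z_i|$, and $\operatorname{sdepth} M$ is the maximum of $\operatorname{sdepth}\mathcal{D}$ over all Stanley decompositions $\mathcal{D}$ of $M$. *)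

(* Defs.v *)
From HB Require Import structures.
From mathcomp Require Import all_boot all_order all_algebra.
From mathcomp Require Import generic_quotient ring_quotient boolp mpoly.

Set Implicit Arguments.
Unset Strict Implicit.
Unset Printing Implicit Defensive.

Import GRing.Theory.
Local Open Scope ring_scope.
Local Open Scope quotient_scope.

(* Ideals of a commutative ring; unlike for the library's [idealr], the unit
   ideal is allowed. *)
HB.mixin Record isMulAbsorbing (R : comNzRingType) (I : {pred R}) := {
  ring_idealM : forall a u : R, u \in I -> a * u \in I }.

#[short(type="ringIdeal")]
HB.structure Definition RingIdeal (R : comNzRingType) :=
  {I of GRing.ZmodClosed R I & isMulAbsorbing R I}.

Section StanleyDepth.

Variables (K : fieldType) (n : nat).
Local Notation S := {mpoly K[n]}.
Local Notation deg := {ffun 'I_n -> int}.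

Definition mdegz (m : 'X_{1..n}) : deg := [ffun i => (m i)%:Z].

Definition mono_in (Z : {set 'I_n}) (m : 'X_{1..n}) : bool :=
  [forall i, (m i != 0)%N ==> (i \in Z)].

(* The subring K[Z] of S. *)
Definition poly_in (Z : {set 'I_n}) (p : S) : bool := all (mono_in Z) (msupp p).

Section Module.

Variable M : lmodType S.

(* [G a u] reads "u belongs to the component M_a"; the field K acts on M
   through the constant polynomials. *)
Record is_zngrading (G : deg -> M -> Prop) : Prop := {
  zngrading0 : forall a, G a 0;
  zngradingD : forall a u v, G a u -> G a v -> G a (u + v);
  zngradingZ : forall a (c : K) u, G a u -> G a (c%:MP *: u);
  zngradingX : forall a m u, G a u -> G (a + mdegz m) ('X_[m] *: u);
  zngrading_sum : forall u, exists (s : seq deg) (f : deg -> M),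
    (forall a, G a (f a)) /\ u = \sum_(a <- s) f a;
  zngrading_direct : forall (s : seq deg) (f : deg -> M), uniq s ->
    (forall a, G a (f a)) -> \sum_(a <- s) f a = 0 ->
    forall a, a \in s -> f a = 0 }.

Definition homogeneous (G : deg -> M -> Prop) (u : M) : Prop := exists a, G a u.

Definition Kspan (P : M -> Prop) (x : M) : Prop :=
  exists s : seq (K * M),
    (forall cw, cw \in s -> P cw.2) /\ x = \sum_(cw <- s) cw.1%:MP *: cw.2.

(* The K-subspace uK[Z] of M. *)
Definition spanKZ (u : M) (Z : {set 'I_n}) : M -> Prop :=
  Kspan (fun w => exists2 m, mono_in Z m & w = 'X_[m] *: u).

(* Only finite bases are considered: this is no restriction for the finitely
   generated K[Z]-modules uK[Z]. *)
Definition free_over (Z : {set 'I_n}) (N : M -> Prop) : Prop :=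
  exists (k : nat) (b : 'I_k -> M), (forall j, N (b j)) /\
    forall x, N x -> exists! c : {ffun 'I_k -> S},
      (forall j, poly_in Z (c j)) /\ x = \sum_(j < k) c j *: b j.

(* u = 0 is excluded because 0 is free of rank zero over K[Z], hence not of
   dimension |Z|. *)
Definition stanley_space (G : deg -> M -> Prop) (u : M) (Z : {set 'I_n}) : Prop :=
  [/\ homogeneous G u, u != 0 & free_over Z (spanKZ u Z)].

(* A decomposition is given by the list of the pairs (u_i, Z_i).  Each u_iK[Z_i]
   is a graded subspace since u_i is homogeneous. *)
Definition stanley_decomposition (G : deg -> M -> Prop)
    (D : seq (M * {set 'I_n})) : Prop :=
  (forall uZ, uZ \in D -> stanley_space G uZ.1 uZ.2) /\
  forall x : M, exists! f : {ffun 'I_(size D) -> M},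
    (forall i, spanKZ (tnth (in_tuple D) i).1 (tnth (in_tuple D) i).2 (f i)) /\
    x = \sum_i f i.

(* The neutral element n is harmless, as every |Z_i| is at most n. *)
Definition sdepth_dec (D : seq (M * {set 'I_n})) : nat :=
  \big[minn/n]_(uZ <- D) #|uZ.2|.

(* Bounding d by n loses nothing since sdepth_dec D <= n.  A nonzero finitely
   generated graded module has a Stanley decomposition, so that the maximum is
   over a nonempty set. *)
Definition sdepth (G : deg -> M -> Prop) : nat :=
  \max_(d < n.+1 |
    `[< exists D, stanley_decomposition G D /\ sdepth_dec D = d >]) d.

End Module.

Section Quotient.

Variable I : ringIdeal S.

Definition mpoly_quot : Type := {ideal_quot I}.
HB.instance Definition _ := GRing.Zmodule.on mpoly_quot.

Definition to_quot (p : S) : mpoly_quot := \pi_{ideal_quot I} p.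

Definition quot_scale (p : S) (x : mpoly_quot) : mpoly_quot :=
  to_quot (p * repr (x : {ideal_quot I})).

Fact to_quotB : zmod_morphism to_quot.
Proof. exact: (raddfB \pi_{ideal_quot I}). Qed.

HB.instance Definition _ :=
  GRing.isZmodMorphism.Build S mpoly_quot to_quot to_quotB.

Lemma to_quot_eq0 p : (to_quot p == 0) = (p \in I).
Proof.
rewrite -[p in RHS]subr0 (Quotient.idealrBE I p 0).
by rewrite /to_quot -(raddf0 \pi_{ideal_quot I}).
Qed.

Lemma to_quot_surj x : exists p, x = to_quot p.
Proof. by exists (repr (x : {ideal_quot I})); rewrite /to_quot reprK. Qed.

Lemma quot_scaleE p q : quot_scale p (to_quot q) = to_quot (p * q).
Proof.
apply/eqP; rewrite -subr_eq0 -raddfB to_quot_eq0 -mulrBr.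
by apply: ring_idealM; rewrite -to_quot_eq0 raddfB /= [X in X - _]reprK subrr.
Qed.

Lemma quot_scaleA p q x :
  quot_scale p (quot_scale q x) = quot_scale (p * q) x.
Proof. by have [r ->] := to_quot_surj x; rewrite !quot_scaleE mulrA. Qed.

Lemma quot_scale1 : left_id 1 quot_scale.
Proof. by move=> x; have [r ->] := to_quot_surj x; rewrite quot_scaleE mul1r. Qed.

Lemma quot_scaleDr : right_distributive quot_scale +%R.
Proof.
move=> p x y; have [r ->] := to_quot_surj x; have [t ->] := to_quot_surj y.
by rewrite -raddfD !quot_scaleE mulrDr raddfD.
Qed.

Lemma quot_scaleDl x : {morph quot_scale^~ x : p q / p + q}.
Proof.
move=> p q; have [r ->] := to_quot_surj x.
by rewrite !quot_scaleE mulrDl raddfD.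
Qed.

HB.instance Definition _ := GRing.Zmodule_isLmodule.Build S mpoly_quot
  quot_scaleA quot_scale1 quot_scaleDr quot_scaleDl.

(* The standard grading of S, and the one it induces on S/I. *)
Definition mpoly_comp (a : deg) (p : S) : Prop :=
  forall m, m \in msupp p -> mdegz m = a.

Definition quot_comp (a : deg) (x : mpoly_quot) : Prop :=
  exists2 p, mpoly_comp a p & x = to_quot p.

End Quotient.

(* The prime ideal generated by the variables x_i, i in Z. *)
Definition var_ideal (Z : {set 'I_n}) : {pred S} :=
  fun p : S => `[< exists c : 'I_n -> S, p = \sum_(i in Z) c i * 'X_i >].

Fact var_ideal_zmod Z : zmod_closed (var_ideal Z).
Proof.
split; first by apply/asboolP; exists (fun=> 0); rewrite big1 // => i _; rewrite mul0r.
move=> p q /asboolP[c ->] /asboolP[d ->]; apply/asboolP.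
exists (fun i => c i - d i); rewrite -sumrB.
by apply: eq_bigr => i _; rewrite mulrBl.
Qed.

Fact var_idealM Z (a u : S) : u \in var_ideal Z -> a * u \in var_ideal Z.
Proof.
move=> /asboolP[c ->]; apply/asboolP; exists (fun i => a * c i).
by rewrite mulr_sumr; apply: eq_bigr => i _; rewrite mulrA.
Qed.

HB.instance Definition _ Z :=
  GRing.isZmodClosed.Build S (var_ideal Z) (var_ideal_zmod Z).
HB.instance Definition _ Z :=
  isMulAbsorbing.Build S (var_ideal Z) (@var_idealM Z).

Definition ideal_meet (I J : {pred S}) : {pred S} := [predI I & J].

Fact ideal_meet_zmod (I J : ringIdeal S) : zmod_closed (ideal_meet I J).
Proof.
split; first by rewrite inE !rpred0.
by move=> p q; rewrite !inE => /andP[? ?] /andP[? ?]; rewrite !rpredB.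
Qed.

Fact ideal_meetM (I J : ringIdeal S) (a u : S) :
  u \in ideal_meet I J -> a * u \in ideal_meet I J.
Proof. by rewrite !inE => /andP[? ?]; rewrite !ring_idealM. Qed.

HB.instance Definition _ (I J : ringIdeal S) :=
  GRing.isZmodClosed.Build S (ideal_meet I J) (ideal_meet_zmod I J).
HB.instance Definition _ (I J : ringIdeal S) :=
  isMulAbsorbing.Build S (ideal_meet I J) (@ideal_meetM I J).

(* The grading of S is compatible with monomial ideals, in particular with
   intersections of ideals generated by variables. *)
Definition monomial_ideal (I : {pred S}) : Prop :=
  forall (p : S) m, p \in I -> m \in msupp p -> 'X_[m] \in I.

Lemma var_ideal_monomial Z : monomial_ideal (var_ideal Z).
Proof.
move=> p m /asboolP[c ->] /msupp_sum_le /flattenP[s /mapP[i]].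
rewrite mem_filter => /andP[iZ _] -> /=; rewrite (perm_mem (msuppMX _ _)).
case/mapP=> m' _ ->; apply/asboolP.
exists (fun j => if j == i then 'X_[m'] else 0).
rewrite (bigD1 i) //= eqxx big1 ?addr0 ?mpolyXD 1?mulrC //.
by move=> j /andP[_ /negPf->]; rewrite mul0r.
Qed.

Lemma ideal_meet_monomial (I J : {pred S}) :
  monomial_ideal I -> monomial_ideal J -> monomial_ideal (ideal_meet I J).
Proof.
by move=> hI hJ p m; rewrite !inE => /andP[pI pJ] mp; rewrite (hI p) ?(hJ p).
Qed.

Lemma quot_comp_grading (I : ringIdeal S) :
  monomial_ideal I -> is_zngrading (@quot_comp I).
Proof.
move=> monI; split.
- by move=> a; exists 0 => [m|]; rewrite ?msupp0 // raddf0.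
- move=> a _ _ [p pa ->] [q qa ->]; exists (p + q); rewrite ?raddfD //.
  by move=> m /msuppD_le; rewrite mem_cat => /orP[/pa|/qa].
- move=> a c _ [p pa ->]; exists (c%:MP * p); last exact: quot_scaleE.
  by move=> m; rewrite mul_mpolyC => /msuppZ_le /pa.
- move=> a m _ [p pa ->]; exists ('X_[m] * p); last exact: quot_scaleE.
  move=> m'; rewrite mulrC (perm_mem (msuppMX _ _)) => /mapP[m1 /pa <- ->].
  by apply/ffunP => i; rewrite !ffunE mnmDE -PoszD addnC.
- move=> u; have [p ->] := to_quot_surj u.
  pose part a := \sum_(m <- msupp p | mdegz m == a) p@_m *: 'X_[m].
  exists (undup [seq mdegz m | m <- msupp p]), (fun a => to_quot I (part a)); split.
    move=> a; exists (part a) => // m /msupp_sum_le /flattenP[s /mapP[m']].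
    rewrite mem_filter => /andP[/eqP <- _] -> /msuppZ_le.
    by rewrite msuppX inE => /eqP ->.
  rewrite -raddf_sum; congr to_quot; rewrite (exchange_big_dep xpredT) //=.
  rewrite [LHS]mpolyE; apply: eq_big_seq => m mp.
  under eq_bigl do rewrite eq_sym.
  by rewrite -big_filter filter_pred1_uniq ?big_seq1 ?undup_uniq ?mem_undup ?map_f.
- move=> s f uniq_s fG sum0 a sa.
  have /choice[p pP] b : exists p, f b = to_quot I p /\ mpoly_comp b p.
    by have [p ? ?] := fG b; exists p.
  have pf b : f b = to_quot I (p b) by have [] := pP b.
  rewrite pf; apply/eqP; rewrite to_quot_eq0.
  have sumI : \sum_(b <- s) p b \in I.
    by rewrite -to_quot_eq0 raddf_sum; apply/eqP; rewrite -[RHS]sum0;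
      apply: eq_bigr => b _; rewrite pf.
  rewrite [p a]mpolyE big_seq; apply: rpred_sum => m mpa.
  rewrite -mul_mpolyC; apply: ring_idealM; apply: (monI _ _ sumI).
  rewrite mcoeff_msupp raddf_sum /= (bigD1_seq a) //= big1 ?addr0.
    by rewrite -mcoeff_msupp.
  move=> b ba; apply/eqP; rewrite mcoeff_eq0; apply/negP => mpb.
  have [_ /(_ _ mpb) eb] := pP b; have [_ /(_ _ mpa) ea] := pP a.
  by rewrite -eb ea eqxx in ba.
Qed.

End StanleyDepth.

Arguments var_ideal K {n} Z.
Arguments quot_comp {K n} I.

(* Main.v *)
Require Import Defs.
From mathcomp Require Import all_boot all_algebra boolp mpoly zify.

Set Implicit Arguments.
Unset Strict Implicit.
Unset Printing Implicit Defensive.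

(** A Stanley decomposition of S/I, for a monomial ideal I, is a matter of
    monomials: each graded component of S/I has dimension at most one, so a
    Stanley space uK[Z] has a monomial u = X^mu up to a scalar, and the
    decomposition says that every monomial outside I lies in exactly one of the
    sets X^mu * Mon(K[Z]). Among squarefree monomials such a set is empty when
    mu is not squarefree, and otherwise it is the interval of the subsets of
    the variables between supp(mu) and supp(mu) U Z. A Stanley decomposition of
    depth d thus gives a partition of the complex Delta = {F : X^F not in I}
    into intervals whose tops are faces with at least d elements
    ([stanley_interval_partition]).

    For I = P1 /\ P2 /\ P3, with blocks of variables A, B, C of sizes
    r <= e <= q, the complex consists of the sets that miss one of the blocks.
    The bound comes from the interval [b, t] that contains A. As t is a face
    that meets A, it misses B or C; in other words one of the two blocks is not
    entered by the interval of A. If X is that block, the faces obtained from A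
    by adding one j in X lie in intervals [b_j, t_j] different from that of A,
    which forces j in b_j; and t_j stays inside A U X, since it meets A and X.
    Two of these intervals cannot both contain A + j + k. Counting pairs, the
    average number of k for which A + j + k lies in [b_j, t_j] is at most
    (|X| - 1) / 2, and so d <= r + ceil(|X| / 2) ([interval_depth_le]). For
    X = B this is already at most r + min(e, ceil(q / 2)). For X = C it is
    r + ceil(q / 2), while t, contained in A U B, gives d <= r + e
    ([three_facets_depth_le]). *)

(** * Interval partitions of a family of sets *)

(** Counting the arcs in both directions: an oriented simple graph on C has at
    most |C| (|C| - 1) / 2 of them, which bounds the least out-degree. *)
Lemma oriented_outdegree (T : finType) (C : {set T}) (a : rel T) (m : nat) :
  C != set0 ->
  {in C &, forall j k, a j k -> a k j -> j = k} ->
  {in C, forall j, m <= #|[set k in C | (k != j) && a j k]|} ->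
  m.*2 < #|C|.
Proof.
move=> C0 asym deg; have cC : 0 < #|C| by rewrite card_gt0.
suff : #|C| * m.*2 <= #|C| * #|C|.-1 by rewrite leq_mul2l => /orP[]; lia.
pose b j k : nat := (k != j) && a j k.
have degE j : #|[set k in C | (k != j) && a j k]| = \sum_(k in C) b j k.
  by rewrite -sum1dep_card big_mkcondr; apply: eq_bigr => k _; rewrite /b; case: ifP.
have arcs : #|C| * m <= \sum_(j in C) \sum_(k in C) b j k.
  by rewrite -sum_nat_const; apply: leq_sum => j jC; rewrite -degE deg.
rewrite -addnn mulnDr; apply: (leq_trans (leq_add arcs arcs)).
rewrite [X in _ + X <= _]exchange_big -big_split -sum_nat_const /=.
apply: leq_sum => j jC; rewrite -big_split (bigD1 j) //= /b eqxx add0n.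
have -> : #|C|.-1 = \sum_(k in C | k != j) 1.
  by rewrite sum1dep_card (cardD1 j C) jC; apply: eq_card => k; rewrite !inE andbC.
apply: leq_sum => k /andP[kC kj]; rewrite kj eq_sym kj /=.
by case ajk: (a j k); case akj: (a k j) => //; rewrite (asym j k) ?eqxx in kj.
Qed.

(** An interval is encoded by its pair (bottom, top). When the family is a
    simplicial complex, asking that the tops belong to it is the same as asking
    that the intervals be contained in it. *)
Record interval_partition (T : finType) (Delta : {set {set T}})
    (P : {set {set T} * {set T}}) : Prop := {
  interval_top : forall I, I \in P -> I.2 \in Delta;
  interval_cover : forall F, F \in Delta ->
    exists2 I, I \in P & (I.1 \subset F) && (F \subset I.2);
  interval_disjoint : forall (I J : {set T} * {set T}) (F : {set T}),
    I \in P -> J \in P ->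
    (I.1 \subset F) && (F \subset I.2) -> (J.1 \subset F) && (F \subset J.2) ->
    I = J }.

(** The local form of the fact that the maximal ideal in |C| variables has
    Stanley depth at most ceil(|C| / 2): this is the case of the empty A, and
    in general the link of A is considered instead of the complex. Whether the
    interval of j |: A also contains k |: (j |: A) orients the pair {j, k}. *)
Lemma interval_depth_le (T : finType) (Delta : {set {set T}})
    (P : {set {set T} * {set T}}) (d : nat) (A C : {set T}) :
  interval_partition Delta P -> (forall I, I \in P -> d <= #|I.2|) ->
  C != set0 -> [disjoint A & C] ->
  {in C, forall j, j |: A \in Delta} ->
  (forall F, F \in Delta -> A \subset F -> ~~ [disjoint C & F] ->
     F \subset A :|: C) ->
  (forall I, I \in P -> I.1 \subset A -> A \subset I.2 -> [disjoint C & I.2]) ->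
  d <= #|A| + uphalf #|C|.
Proof.
case=> top cov disj dP C0 dAC jA onlyC sepC.
have /fin_all_exists[f fP] j : exists I, j \in C ->
    [/\ I \in P, I.1 \subset j |: A & j |: A \subset I.2].
  case: (boolP (j \in C)) => [/jA/cov[I IP /andP[? ?]]|]; last by exists (set0, set0).
  by exists I.
have jA' j : j \in C -> j \notin A by move=> jC; rewrite (disjointFl dAC).
have jtop j : j \in C -> j \in (f j).2.
  by move=> /fP[_ _ /subsetP]; apply; rewrite setU11.
have jbot j : j \in C -> j \in (f j).1.
  (* Otherwise the interval of j |: A would contain A as well. *)
  move=> jC; have [fjP bs st] := fP j jC; apply: contraT => jb.
  have bA : (f j).1 \subset A.
    apply/subsetP => x xb; have := subsetP bs x xb; rewrite !inE.
    by case/orP => // /eqP xj; rewrite xj (negPf jb) in xb.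
  have := sepC _ fjP bA (subset_trans (subsetUr _ _) st).
  by move/disjointFr => /(_ j jC); rewrite jtop.
suff : (d - #|A|.+1).*2 < #|C| by clear; lia.
apply: (@oriented_outdegree _ _ (fun j k => k \in (f j).2)) => // [j k jC kC kj jk|j jC].
  have [fjP bsj stj] := fP j jC; have [fkP bsk stk] := fP k kC.
  have fjk : f j = f k.
    apply: (disj _ _ (j |: (k |: A))) => //.
    - rewrite (subset_trans bsj) ?setUS ?subsetUr //.
      by move: stj; rewrite !subUset !sub1set => /andP[-> ->]; rewrite kj.
    - by rewrite (subset_trans bsk) ?subsetUr // subUset sub1set jk.
  have := jbot j jC; rewrite fjk => /(subsetP bsk).
  by rewrite !inE (negPf (jA' j jC)) orbF => /eqP.
have [fjP bs st] := fP j jC.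
have sAC : (f j).2 \subset A :|: C.
  apply: onlyC; rewrite ?top // ?(subset_trans (subsetUr _ _) st) //.
  by apply/pred0Pn; exists j; rewrite /= jC jtop.
rewrite leq_subLR (leq_trans (dP _ fjP)) //.
have -> : #|A|.+1 = #|j |: A| by rewrite cardsU1 jA'.
apply: leq_trans (leq_card_setU _ _); apply: subset_leq_card.
apply/subsetP => k kt; have := subsetP sAC k kt; rewrite !inE kt andbT.
by case: (k == j); rewrite // andbT.
Qed.

(** Both ways in which the top of the interval of A can miss a block are
    settled by [interval_depth_le], applied to the block that is missed; when
    this is the larger block C, the size of the top gives the bound by #|B|. *)
Lemma three_facets_depth_le (T : finType) (A B C : {set T})
    (P : {set {set T} * {set T}}) (d : nat) :
  A :|: B :|: C = setT ->
  [disjoint A & B] -> [disjoint A & C] -> [disjoint B & C] ->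
  0 < #|A| -> 0 < #|B| -> #|B| <= #|C| ->
  interval_partition
    [set F : {set T} |
      [|| [disjoint A & F], [disjoint B & F] | [disjoint C & F]]] P ->
  (forall I, I \in P -> d <= #|I.2|) ->
  d <= #|A| + minn #|B| (uphalf #|C|).
Proof.
move=> ABC dAB dAC dBC A0 B0 BC part depth.
have memABC i : (i \in A) || (i \in B) || (i \in C) by rewrite -!in_setU ABC inE.
have notB (F : {set T}) : [disjoint B & F] -> F \subset A :|: C.
  move=> dBF; apply/subsetP => i iF; have := memABC i.
  by rewrite (disjointFl dBF iF) orbF inE.
have notC (F : {set T}) : [disjoint C & F] -> F \subset A :|: B.
  move=> dCF; apply/subsetP => i iF; have := memABC i.
  by rewrite (disjointFl dCF iF) orbF inE.
have meetA (F : {set T}) : A \subset F -> [disjoint A & F] = false.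
  move=> AF; apply/negbTE; case/card_gt0P: A0 => i iA; apply/pred0Pn; exists i.
  by rewrite /= iA (subsetP AF).
have disjU (X Y : {set T}) j : [disjoint X & A] -> [disjoint Y & X] -> j \in Y ->
    [disjoint X & j |: A].
  move=> XA YX jY; rewrite disjoint_sym disjoints_subset subUset sub1set.
  by rewrite -disjoints_subset disjoint_sym XA inE (disjointFr YX).
have [|J JP /andP[bJ tJ]] := interval_cover part (F := A).
  by rewrite inE [[disjoint B & A]]disjoint_sym dAB orbT.
have same I : I \in P -> I.1 \subset A -> A \subset I.2 -> I = J.
  by move=> IP bI tI; apply: (interval_disjoint part (F := A)) => //; apply/andP.
have := interval_top part JP; rewrite inE meetA //= addn_minr leq_min.
case/orP => [JB|JC].
  have : d <= #|A| + uphalf #|B|.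
    apply: (interval_depth_le part) => //.
    - by rewrite -card_gt0.
    - by move=> j jB; rewrite inE (disjU C B) ?orbT // disjoint_sym.
    - move=> F; rewrite inE => dF AF; move: dF; rewrite meetA //=.
      by case/orP => [-> //|FC] _; apply: notC.
    - by move=> I IP bI tI; rewrite (same I).
  by clear -BC; lia.
apply/andP; split.
  rewrite (leq_trans (depth _ JP)) // (leq_trans (subset_leq_card (notC _ JC))) //.
  exact: leq_card_setU.
apply: (interval_depth_le part) => //.
- by rewrite -card_gt0 (leq_trans B0).
- by move=> j jC; rewrite inE (disjU B C) ?orbT // disjoint_sym.
- move=> F; rewrite inE => dF AF; move: dF; rewrite meetA //=.
  by case/orP => [FB _|-> //]; apply: notB.
- by move=> I IP bI tI; rewrite (same I).
Qed.

(** * Stanley decompositions of the quotient by a monomial ideal *)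

Section MonomialQuotient.

Import GRing.Theory.
Local Open Scope ring_scope.

Variables (K : fieldType) (n : nat) (I : ringIdeal {mpoly K[n]}).
Local Notation S := {mpoly K[n]}.
Local Notation M := (mpoly_quot I).

Lemma scale_to_quot (p q : S) : p *: to_quot I q = to_quot I (p * q).
Proof. exact: quot_scaleE. Qed.

Lemma mdegz_inj : injective (@mdegz n).
Proof.
move=> m m' /ffunP mm; apply/mnmP => i.
by have := mm i; rewrite !ffunE => -[].
Qed.

(** Each graded component of S is spanned by a monomial. *)
Lemma quot_homogeneous (u : M) :
  homogeneous (quot_comp I) u -> u != 0 ->
  exists c m, c != 0 /\ u = to_quot I (c *: 'X_[m]).
Proof.
case=> a [p pa ->]; rewrite to_quot_eq0 => pI.
have p0 : p != 0 by apply: contraNneq pI => ->; rewrite rpred0.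
have mp := mlead_supp p0; exists p@_(mlead p), (mlead p); split.
  by rewrite -mcoeff_msupp.
congr to_quot; rewrite [LHS]mpolyE (bigD1_seq (mlead p)) //= big_seq_cond.
rewrite big1 ?addr0 // => m /andP[/pa ma]; rewrite -(pa _ mp) in ma.
by rewrite (mdegz_inj ma) eqxx.
Qed.

Lemma spanKZ_support (c : K) (mu : 'X_{1..n}) (Z : {set 'I_n}) (x : M) :
  spanKZ (to_quot I (c *: 'X_[mu])) Z x ->
  exists2 p, x = to_quot I p &
    forall m, m \in msupp p -> exists2 v, mono_in Z v & m = (v + mu)%MM.
Proof.
case=> s [sP ->]; elim: s sP => [|[a w] s IH] sP.
  by exists 0; [rewrite big_nil raddf0 | move=> m; rewrite msupp0].
have [|p pE pP] := IH; first by move=> cw cws; apply: sP; rewrite inE cws orbT.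
have /= [v vZ wE] := sP (a, w) (mem_head _ _).
exists (a%:MP * ('X_[v] * (c *: 'X_[mu])) + p).
  by rewrite big_cons /= pE wE (scale_to_quot 'X_[v]) scale_to_quot raddfD.
move=> m /msuppD_le; rewrite mem_cat => /orP[|/pP //].
rewrite mul_mpolyC -scalerAr -mpolyXD => /msuppZ_le/msuppZ_le.
by rewrite msuppX inE => /eqP ->; exists v.
Qed.

Lemma spanKZ_monomial (c : K) (mu v : 'X_{1..n}) (Z : {set 'I_n}) :
  c != 0 -> mono_in Z v ->
  spanKZ (to_quot I (c *: 'X_[mu])) Z (to_quot I 'X_[v + mu]).
Proof.
move=> c0 vZ; exists [:: (c^-1, 'X_[v] *: to_quot I (c *: 'X_[mu]))]; split.
  by move=> cw; rewrite inE => /eqP -> /=; exists v.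
rewrite big_seq1 /= (scale_to_quot 'X_[v]) scale_to_quot mul_mpolyC -scalerAr.
by rewrite scalerA mulVf // scale1r mpolyXD.
Qed.

(** Multiply by 'X_[v] the coordinates of u in a basis of uK[Z]: the products
    are coordinates of 0, hence vanish, and S is a domain. *)
Lemma free_over_torsion_free (u : M) (Z : {set 'I_n}) (v : 'X_{1..n}) :
  free_over Z (spanKZ u Z) -> mono_in Z v -> 'X_[v] *: u = 0 -> u = 0.
Proof.
case=> k [b [bN basis]] vZ vu0.
have uN : spanKZ u Z u.
  exists [:: (1, u)]; split=> [cw|]; last by rewrite big_seq1 /= scale1r.
  rewrite inE => /eqP -> /=; exists 0%MM; last by rewrite mpolyX0 scale1r.
  by apply/forallP => i; rewrite mnm0E.
have zN : spanKZ u Z 0 by exists [::]; split=> //; rewrite big_nil.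
have [c [[cZ uE] _]] := basis u uN.
have [z [_ zU]] := basis 0 zN.
have z0 : z = [ffun => 0].
  apply: zU; split=> [j|]; first by rewrite ffunE /poly_in msupp0.
  by rewrite big1 // => j _; rewrite ffunE scale0r.
have zc : z = [ffun j => 'X_[v] * c j].
  apply: zU; split=> [j|].
    rewrite ffunE /poly_in; apply/allP => m; rewrite mulrC (perm_mem (msuppMX _ _)).
    case/mapP=> m' m'c ->; have /allP/(_ _ m'c)/forallP m'Z := cZ j.
    apply/forallP => i; rewrite mnmDE addn_eq0 negb_and.
    by apply/implyP => /orP[]; apply/implyP; [move/forallP: vZ|apply: m'Z].
  rewrite -[LHS]vu0 [in LHS]uE scaler_sumr; apply: eq_bigr => j _.
  by rewrite ffunE scalerA.
have c0 j : c j = 0.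
  move: (congr1 (fun f : {ffun 'I_k -> S} => f j) zc).
  rewrite /= z0 !ffunE => /esym/eqP.
  by rewrite mulf_eq0 -msupp_eq0 msuppX => /eqP.
by rewrite uE big1 // => j _; rewrite c0 scale0r.
Qed.

Lemma stanley_piece_monomial (c : K) (mu v : 'X_{1..n}) (Z : {set 'I_n}) :
  free_over Z (spanKZ (to_quot I (c *: 'X_[mu])) Z) ->
  to_quot I (c *: 'X_[mu]) != 0 -> mono_in Z v -> 'X_[v + mu] \notin I.
Proof.
move=> fr u0 vZ; apply: contra u0 => XI.
apply/eqP; apply: (free_over_torsion_free fr vZ).
rewrite scale_to_quot -scalerAr -mpolyXD -mul_mpolyC.
by apply/eqP; rewrite to_quot_eq0 ring_idealM.
Qed.

Hypothesis monoI : monomial_ideal I.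

(** The difference between 'X_[m] and a sum of representatives of its
    components lies in I; as 'X_[m] does not, m occurs in a representative. *)
Lemma stanley_decomposition_cover (D : seq (M * {set 'I_n}))
    (c : 'I_(size D) -> K) (mu : 'I_(size D) -> 'X_{1..n}) (m : 'X_{1..n}) :
  stanley_decomposition (quot_comp I) D ->
  (forall i, (tnth (in_tuple D) i).1 = to_quot I (c i *: 'X_[mu i])) ->
  'X_[m] \notin I ->
  exists i, exists2 v, mono_in (tnth (in_tuple D) i).2 v & m = (v + mu i)%MM.
Proof.
case=> _ dec uE mI; have [f [[fZ mE] _]] := dec (to_quot I 'X_[m]).
have /fin_all_exists[p pP] i : exists p, f i = to_quot I p /\
    forall m, m \in msupp p ->
    exists2 v, mono_in (tnth (in_tuple D) i).2 v & m = (v + mu i)%MM.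
  by have := fZ i; rewrite uE => /spanKZ_support[p pE pP]; exists p.
have dI : 'X_[m] - \sum_i p i \in I.
  rewrite -to_quot_eq0 raddfB raddf_sum /= mE subr_eq0.
  by apply/eqP/eq_bigr => i _; have [] := pP i.
have : m \in msupp (\sum_i p i).
  apply: contraR mI => mp; apply: (monoI dI).
  rewrite mcoeff_msupp mcoeffB mcoeffX eqxx.
  by rewrite (memN_msupp_eq0 mp) subr0 oner_neq0.
move=> /msupp_sum_le/flattenP[s /mapP[i _ ->]] mp.
by exists i; have [_ /(_ _ mp)] := pP i.
Qed.

Lemma stanley_decomposition_disjoint (D : seq (M * {set 'I_n}))
    (c : 'I_(size D) -> K) (mu : 'I_(size D) -> 'X_{1..n}) (m : 'X_{1..n})
    (i j : 'I_(size D)) :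
  stanley_decomposition (quot_comp I) D ->
  (forall i, (tnth (in_tuple D) i).1 = to_quot I (c i *: 'X_[mu i])) ->
  (forall i, c i != 0) ->
  'X_[m] \notin I ->
  (exists2 v, mono_in (tnth (in_tuple D) i).2 v & m = (v + mu i)%MM) ->
  (exists2 v, mono_in (tnth (in_tuple D) j).2 v & m = (v + mu j)%MM) ->
  i = j.
Proof.
case=> _ dec uE c0 mI im jm.
have [f [_ fU]] := dec (to_quot I 'X_[m]).
have single k :
    (exists2 v, mono_in (tnth (in_tuple D) k).2 v & m = (v + mu k)%MM) ->
    f = [ffun l => if l == k then to_quot I 'X_[m] else 0].
  case=> v vZ mE; apply: fU; split=> [l|].
    rewrite ffunE; case: eqP => [->|_].
      by rewrite uE mE; apply: spanKZ_monomial.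
    by exists [::]; split=> //; rewrite big_nil.
  rewrite (bigD1 k) //= ffunE eqxx big1 ?addr0 // => l /negPf lk.
  by rewrite ffunE lk.
have fi := single i im.
have := congr1 (fun g : {ffun _ -> M} => g i) (single j jm).
rewrite /= {1}fi !ffunE eqxx; case: eqP => // _ /eqP.
by rewrite to_quot_eq0 (negPf mI).
Qed.

(** For a squarefree I this is the simplicial complex whose Stanley-Reisner
    ring is S/I. *)
Definition squarefree_complex : {set {set 'I_n}} :=
  [set F | 'X_[mesym1 F] \notin I].

Lemma mesym1_interval (mu : 'X_{1..n}) (Z F : {set 'I_n}) :
  let supp := [set k | mu k != 0] in
  (exists2 v, mono_in Z v & mesym1 F = (v + mu)%MM) <->
  (forall k, mu k <= 1)%N /\ (supp \subset F) && (F \subset supp :|: Z).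
Proof.
move=> supp; split=> [[v /forallP vZ /mnmP FE]|[mu1 /andP[/subsetP sF /subsetP Fs]]].
  have {}FE k : (k \in F : nat) = (v k + mu k)%N by rewrite -mnmDE -FE mnmE.
  split=> [k|]; first by have := FE k; case: (k \in F); lia.
  apply/andP; split; apply/subsetP => k; rewrite !inE.
    by have := FE k; case: (k \in F) => //; lia.
  by move=> kF; have := FE k; have := vZ k; rewrite kF; case: (k \in Z); lia.
exists [multinom ((k \in F) - mu k)%N | k < n].
  apply/forallP => k; rewrite mnmE; have := Fs k; rewrite !inE.
  case: (k \in F) => // /(_ isT) /orP[mk|->]; last exact: implybT.
  by have := mu1 k; case: (mu k) mk => [|[]].
apply/mnmP => k; rewrite mnmDE !mnmE; have := sF k; rewrite inE; have := mu1 k.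
by case: (mu k) => [|[|//]] _ => [|/(_ isT) ->]; rewrite ?subn0 ?addn0.
Qed.

(** The intervals come from the pieces with a squarefree generator; the others
    contain no squarefree monomial. A top is a face because the pieces, being
    free, do not meet I. *)
Lemma stanley_interval_partition (D : seq (M * {set 'I_n})) (d : nat) :
  stanley_decomposition (quot_comp I) D ->
  (forall uZ, uZ \in D -> d <= #|uZ.2|)%N ->
  exists2 P, interval_partition squarefree_complex P &
    (forall J, J \in P -> d <= #|J.2|)%N.
Proof.
move=> Ddec dD.
have DP (i : 'I_(size D)) := Ddec.1 _ (mem_tnth i (in_tuple D)).
have /fin_all_exists[c /fin_all_exists[mu cmu]] i : exists c m,
    c != 0 /\ (tnth (in_tuple D) i).1 = to_quot I (c *: 'X_[m]).
  by have [hu u0 _] := DP i; apply: quot_homogeneous.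
have c0 i := (cmu i).1; have uE i := (cmu i).2.
pose Z i := (tnth (in_tuple D) i).2; pose supp i := [set k | mu i k != 0].
pose sqfree := [pred i | [forall k, (mu i k <= 1)%N]].
have inP i (F : {set 'I_n}) :
    i \in sqfree -> (supp i \subset F) && (F \subset supp i :|: Z i) ->
    exists2 v, mono_in (Z i) v & mesym1 F = (v + mu i)%MM.
  by move=> /forallP sq iF; apply/mesym1_interval.
have noI i v : mono_in (Z i) v -> 'X_[v + mu i] \notin I.
  have [_ u0 fr] := DP i; rewrite uE in u0 fr.
  exact: stanley_piece_monomial fr u0.
exists [set (supp i, supp i :|: Z i) | i in sqfree]; last first.
  move=> _ /imsetP[i _ ->] /=; apply: leq_trans (subset_leq_card (subsetUr _ _)).
  exact: dD (mem_tnth i (in_tuple D)).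
split.
- move=> _ /imsetP[i sq ->] /=; rewrite inE.
  by have [//||v vZ ->] := inP i (supp i :|: Z i); rewrite ?subsetUl //= ?noI.
- move=> F; rewrite inE => FI.
  have [i iF] := stanley_decomposition_cover Ddec uE FI.
  have [sq iF'] := (mesym1_interval _ _ _).1 iF.
  by exists (supp i, supp i :|: Z i) => //; apply: imset_f; apply/forallP.
- move=> _ _ F /imsetP[i isq ->] /imsetP[j jsq ->] /= /(inP _ _ isq) iF.
  move=> /(inP _ _ jsq) jF.
  have FI : 'X_[mesym1 F] \notin I by have [v vZ ->] := iF; apply: noI.
  by rewrite (stanley_decomposition_disjoint Ddec uE c0 FI iF jF).
Qed.

Lemma sdepth_dec_le (D : seq (M * {set 'I_n})) uZ :
  uZ \in D -> (sdepth_dec D <= #|uZ.2|)%N.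
Proof.
rewrite /sdepth_dec; elim: D => [//|x D IH]; rewrite inE big_cons.
by case/predU1P => [->|/IH h]; [apply: geq_minl | apply: leq_trans h; apply: geq_minr].
Qed.

Lemma sdepth_le_interval_bound (b : nat) :
  (forall P d, interval_partition squarefree_complex P ->
     (forall J, J \in P -> d <= #|J.2|)%N -> (d <= b)%N) ->
  (sdepth (quot_comp I) <= b)%N.
Proof.
move=> bP; apply/bigmax_leqP => d /asboolP[D [Ddec dE]].
have [|P PP Pd] := stanley_interval_partition (d := d) Ddec; last exact: bP PP Pd.
by rewrite -dE => uZ; apply: sdepth_dec_le.
Qed.

End MonomialQuotient.

(** * Intersections of three primes generated by variables *)

Lemma mesym1_in_var_ideal (K : fieldType) (n : nat) (Z F : {set 'I_n}) :
  ('X_[mesym1 F] \in var_ideal K Z)%R = ~~ [disjoint Z & F].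
Proof.
apply/asboolP/pred0Pn => [[c XE]|[i /andP[/= iZ iF]]].
  have : mesym1 F \in msupp (\sum_(i in Z) c i * 'X_i)%R.
    by rewrite -XE msuppX mem_head.
  case/msupp_sum_le/flattenP => s /mapP[i]; rewrite mem_filter => /andP[iZ _] ->.
  rewrite (perm_mem (msuppMX _ _)) => /mapP[m _ /mnmP/(_ i)].
  rewrite mnmDE mnmE mnm1E eqxx => Fi; exists i; rewrite /= iZ.
  by move: Fi; case: (i \in F).
exists (fun j => if j == i then 'X_[mesym1 F - U_(i)] else 0)%R.
rewrite (bigD1 i) //= eqxx big1; last first.
  by move=> j /andP[_ /negPf ->]; rewrite GRing.mul0r.
rewrite GRing.addr0 -mpolyXD submK //.
by apply/mnm_lepP => j; rewrite mnm1E mnmE; case: eqP => // <-; rewrite iF.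
Qed.

Lemma squarefree_complex_meet3 (K : fieldType) (n : nat) (Z1 Z2 Z3 : {set 'I_n}) :
  squarefree_complex
    (ideal_meet (ideal_meet (var_ideal K Z1) (var_ideal K Z2)) (var_ideal K Z3))
  = [set F : {set _} |
      [|| [disjoint Z1 & F], [disjoint Z2 & F] | [disjoint Z3 & F]]].
Proof.
apply/setP => F; rewrite [in RHS]inE inE inE /= [_ \in ideal_meet _ _]inE /=.
by rewrite !mesym1_in_var_ideal !negb_and !negbK orbA.
Qed.

Theorem proposition2p4 (K : fieldType) (n r e q : nat) :
  0 < r -> r <= e -> e <= q -> r + e + q = n ->
  ~ (e = r.+1 /\ odd r) ->
  let P1 := var_ideal K [set i : 'I_n | i < r] in
  let P2 := var_ideal K [set i : 'I_n | r <= i < r + e] in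
  let P3 := var_ideal K [set i : 'I_n | r + e <= i < r + e + q] in
  sdepth (quot_comp (ideal_meet (ideal_meet P1 P2) P3)) <= r + minn e (uphalf q).
Proof.
move=> r0 re eq rn _; lazy zeta.
apply: sdepth_le_interval_bound => [|Q d part depth].
  have mono Z : monomial_ideal (var_ideal K Z) := @var_ideal_monomial K n Z.
  exact: ideal_meet_monomial (ideal_meet_monomial (mono _) (mono _)) (mono _).
rewrite squarefree_complex_meet3 in part.
have cardI a b : b <= n -> #|[set i : 'I_n | a <= i < b]| = b - a.
  move=> bn; rewrite -sum1dep_card -[RHS]muln1 -sum_nat_const_nat.
  rewrite (big_nat_widen _ _ _ _ _ bn) big_geq_mkord; apply: eq_bigl => i.
  by rewrite andbC.
have cA : #|[set i : 'I_n | i < r]| = r by rewrite (cardI 0) ?subn0 //; lia.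
have cB : #|[set i : 'I_n | r <= i < r + e]| = e by rewrite cardI; lia.
have cC : #|[set i : 'I_n | r + e <= i < r + e + q]| = q by rewrite cardI; lia.
have := three_facets_depth_le _ _ _ _ _ _ _ part depth; rewrite cA cB cC; apply=> //.
- by apply/setP => i; rewrite !inE; have := ltn_ord i; lia.
- by apply/pred0P => i; rewrite /= !inE; lia.
- by apply/pred0P => i; rewrite /= !inE; lia.
- by apply/pred0P => i; rewrite /= !inE; lia.
- exact: leq_trans re.
Qed.
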